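(* For positive integers $p$ and $q$, the generating functions $H_{p,q}(z,t)$ satisfy $$H_{p,q}(z,t) = \frac{H_{p-1,q}(z,t) + H_{p,q-1}(z,t) - H_{p-1,q-1}(z,t)}{1 - z^{|p-q|}\,t}$$ if $(p,q)\neq(1,1)$, and $H_{1,1}(z,t) = \frac{1}{1-t}$.
   Context: Let $\mathbb{N}$ be the set of non-negative integers. For $s\in\mathbb{N}$ and a positive integer $n$, let $\mathcal{C}(s,n) = \{(a_1,\dots,a_n)\in\mathbb{N}^n : a_1+\cdots+a_n = s\}$ (compositions of $s$ into $n$ parts, zeros allowed). For positive integers $p,q$, $\mu\in\mathcal{C}(s,p)$ and $\nu\in\mathcal{C}(s,q)$, let $\mathcal{J}_{\mu\nu}$ be the set of $p\times q$ matrices $J$ with non-negative integer entries whose row sums are $\mu$ (i.e. $\sum_j J_{ij}=\mu_i$ for all $i$) and whose column sums are $\nu$ (i.e. $\sum_i J_{ij}=\nu_j$ for all $j$). The discrete Earth Mover's Distance is $$\mathrm{EMD}_s(\mu,\nu) = \min_{J\in\mathcal{J}_{\mu\nu}} \sum_{i=1}^p\sum_{j=1}^q |i-j|\,J_{ij}.$$ For positive integers $p,q$, and indeterminates $z,t$, define the formal power series $$H_{p,q}(z,t) = \sum_{s=0}^\infty \left(\sum_{(\mu,\nu)\in\mathcal{C}(s,p)\times\mathcal{C}(s,q)} z^{\mathrm{EMD}_s(\mu,\nu)}\right) t^s,$$ and set $H_{p,q}(z,t)=0$ if either of $p$ or $q$ is not positive. The quotient in the claim is taken in the ring of formal power series in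 $t$ with coefficients in polynomials in $z$ (where $1-z^{|p-q|}t$ is invertible via the geometric series). *)

(* Defs.v *)
From HB Require Import structures.
From mathcomp Require Import all_boot all_order all_algebra.
From mathcomp Require Import boolp.

Set Implicit Arguments.
Unset Strict Implicit.
Unset Printing Implicit Defensive.

Import GRing.Theory.
Local Open Scope ring_scope.

(* fcoef f n is the coefficient of t^n. *)
Record fps (R : Type) := Fps { fcoef : nat -> R }.
Arguments Fps {R} fcoef.

Notation "{ 'fps' R }" := (fps R) (at level 0, format "{ 'fps'  R }").

Lemma fpsP (R : Type) (f g : {fps R}) : fcoef f =1 fcoef g -> f = g.
Proof. by case: f g => [f] [g] /= /funext ->. Qed.

HB.instance Definition _ (R : Type) := gen_eqMixin {fps R}.
HB.instance Definition _ (R : Type) := gen_choiceMixin {fps R}.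

Section Zmodule.
Variable R : zmodType.
Implicit Types f g h : {fps R}.

Definition fps_zero : {fps R} := Fps (fun=> 0).
Definition fps_opp f : {fps R} := Fps (fun n => - fcoef f n).
Definition fps_add f g : {fps R} := Fps (fun n => fcoef f n + fcoef g n).

Fact fps_addA : associative fps_add.
Proof. by move=> f g h; apply: fpsP => n /=; rewrite addrA. Qed.
Fact fps_addC : commutative fps_add.
Proof. by move=> f g; apply: fpsP => n /=; rewrite addrC. Qed.
Fact fps_add0 : left_id fps_zero fps_add.
Proof. by move=> f; apply: fpsP => n /=; rewrite add0r. Qed.
Fact fps_addN : left_inverse fps_zero fps_opp fps_add.
Proof. by move=> f; apply: fpsP => n /=; rewrite addNr. Qed.

HB.instance Definition _ :=
  GRing.isZmodule.Build {fps R} fps_addA fps_addC fps_add0 fps_addN.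

Lemma fcoef0 n : fcoef (0 : {fps R}) n = 0. Proof. by []. Qed.
Lemma fcoefN f n : fcoef (- f) n = - fcoef f n. Proof. by []. Qed.
Lemma fcoefD f g n : fcoef (f + g) n = fcoef f n + fcoef g n.
Proof. by []. Qed.
Lemma fcoefB f g n : fcoef (f - g) n = fcoef f n - fcoef g n.
Proof. by []. Qed.

End Zmodule.

Section Ring.
Variable R : comNzRingType.
Implicit Types f g h : {fps R}.

Definition fpsC (c : R) : {fps R} := Fps (fun n => if n is 0%N then c else 0).
Definition fpsX : {fps R} := Fps (fun n => (n == 1%N)%:R).
Definition fps_mul f g : {fps R} :=
  Fps (fun n => \sum_(i < n.+1) fcoef f i * fcoef g (n - i)).

Let trunc m f : {poly R} := \poly_(i < m) fcoef f i.

Let mul_trunc m f g n : (n < m)%N ->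
  fcoef (fps_mul f g) n = (trunc m f * trunc m g)`_n.
Proof.
move=> nm; rewrite coefM; apply: eq_bigr => i _; rewrite !coef_poly.
by rewrite (leq_ltn_trans _ nm) ?(leq_ltn_trans _ nm) ?leq_subr // -ltnS.
Qed.

Fact fps_mulC : commutative fps_mul.
Proof.
by move=> f g; apply: fpsP => n; rewrite !(@mul_trunc n.+1) // mulrC.
Qed.

Let mul_trunc3 f g h n : fcoef (fps_mul (fps_mul f g) h) n =
  (trunc n.+1 f * trunc n.+1 g * trunc n.+1 h)`_n.
Proof.
rewrite (@mul_trunc n.+1) // !coefM; apply: eq_bigr => i _; congr (_ * _).
by rewrite coef_poly ltn_ord (@mul_trunc n.+1).
Qed.

Fact fps_mulA : associative fps_mul.
Proof.
move=> f g h; apply: fpsP => n.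
by rewrite fps_mulC !mul_trunc3 mulrC mulrA.
Qed.

Fact fps_mul1 : left_id (fpsC 1) fps_mul.
Proof.
move=> f; apply: fpsP => n /=.
by rewrite big_ord_recl /= mul1r subn0 big1 ?addr0 // => i _; rewrite mul0r.
Qed.

Fact fps_mulDl : left_distributive fps_mul +%R.
Proof.
move=> f g h; apply: fpsP => n /=; rewrite -big_split /=.
by apply: eq_bigr => i _; rewrite mulrDl.
Qed.

Fact fps_oner_neq0 : fpsC 1 != 0.
Proof.
by apply/eqP => /(congr1 (fun f => fcoef f 0)) /eqP; rewrite /= oner_eq0.
Qed.

HB.instance Definition _ := GRing.Zmodule_isComNzRing.Build {fps R}
  fps_mulA fps_mulC fps_mul1 fps_mulDl fps_oner_neq0.

Lemma fcoef1 n : fcoef (1 : {fps R}) n = (n == 0%N)%:R.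
Proof. by case: n. Qed.

Lemma fcoefM f g n :
  fcoef (f * g) n = \sum_(i < n.+1) fcoef f i * fcoef g (n - i).
Proof. by []. Qed.

Lemma fcoef_sum (I : Type) (r : seq I) (P : pred I) (F : I -> {fps R}) n :
  fcoef (\sum_(i <- r | P i) F i) n = \sum_(i <- r | P i) fcoef (F i) n.
Proof. exact: (big_morph (fun f => fcoef f n)). Qed.

Lemma fcoefCM c f n : fcoef (fpsC c * f) n = c * fcoef f n.
Proof.
rewrite fcoefM big_ord_recl /= subn0 big1 ?addr0 // => i _.
by rewrite mul0r.
Qed.

Lemma fcoefXM f n : fcoef (fpsX * f) n = if n is m.+1 then fcoef f m else 0.
Proof.
case: n => [|n]; rewrite fcoefM big_ord_recl /= ?big_ord0 ?mul0r ?addr0 //.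
rewrite add0r big_ord_recl /= mul1r subSS subn0 big1 ?addr0 // => i _.
by rewrite mul0r.
Qed.

Lemma fcoefX_lt h k n : fcoef h 0 = 0 -> (n < k)%N -> fcoef (h ^+ k) n = 0.
Proof.
move=> h0; elim: k n => // k IHk n ltnk; rewrite exprS fcoefM.
rewrite big_ord_recl h0 mul0r add0r big1 // => i _.
rewrite IHk ?mulr0 // lift0; case: n ltnk i => [|n] ltnk [i ltin] //=.
by rewrite subSS (leq_ltn_trans (leq_subr _ _)).
Qed.

End Ring.

Arguments fpsX {R}.

Section UnitRing.
Variable R : comUnitRingType.
Implicit Types f g h : {fps R}.

Definition fps_unit : {pred {fps R}} :=
  fun f => fcoef f 0 \is a GRing.unit.

(* If u is the constant coefficient of f, then f = u (1 - h) with h of zero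
   constant coefficient, and f^-1 = u^-1 (1 + h + h^2 + ...); only the powers
   h^k with k <= n contribute to the coefficient of t^n. *)
Definition fps_inv f : {fps R} :=
  if f \in fps_unit then
    let c := fpsC (fcoef f 0)^-1 in
    let h := 1 - c * f in
    c * Fps (fun n => \sum_(k < n.+1) fcoef (h ^+ k) n)
  else f.

Fact fps_mulVr : {in fps_unit, left_inverse 1 fps_inv *%R}.
Proof.
move=> f fU; rewrite /fps_inv fU.
set c := fpsC _; set h := 1 - c * f; set G := Fps _.
have fE : c * f = 1 - h by rewrite opprB addrC subrK.
have h0 : fcoef h 0 = 0.
  by rewrite fcoefB fcoefCM fcoef1 mulVr ?subrr.
have GE m n : (n <= m)%N -> fcoef G n = fcoef (\sum_(k < m.+1) h ^+ k) n.
  move=> le_nm; rewrite fcoef_sum /=.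
  rewrite -(big_mkord xpredT (fun k => fcoef (h ^+ k) n)).
  rewrite -(big_mkord xpredT (fun k => fcoef (h ^+ k) n)).
  rewrite [RHS](big_cat_nat (n := n.+1)) //=.
  rewrite [X in _ + X]big1_seq ?addr0 // => k.
  by rewrite mem_index_iota => /and3P[_ ltnk _]; rewrite fcoefX_lt.
rewrite mulrAC fE; apply: fpsP => n.
transitivity (fcoef ((1 - h) * \sum_(k < n.+1) h ^+ k) n).
  rewrite !fcoefM; apply: eq_bigr => i _.
  by rewrite (GE n) // leq_subr.
rewrite -opprB mulNr -subrX1 opprB fcoefB.
by rewrite fcoefX_lt ?subr0.
Qed.

Fact fps_unitPl f g : g * f = 1 -> f \in fps_unit.
Proof.
move=> /(congr1 (fun f => fcoef f 0)); rewrite fcoefM big_ord1 fcoef1 => gf.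
by apply/unitrPr; exists (fcoef g 0); rewrite mulrC.
Qed.

Fact fps_inv_out : {in [predC fps_unit], fps_inv =1 id}.
Proof. by move=> f /negbTE fN; rewrite /fps_inv fN. Qed.

HB.instance Definition _ := GRing.ComNzRing_hasMulInverse.Build {fps R}
  fps_mulVr fps_unitPl fps_inv_out.

Lemma fps_unitE f : (f \is a GRing.unit) = (fcoef f 0 \is a GRing.unit).
Proof. by []. Qed.

Lemma fps_unit_geom (a : R) : 1 - fpsC a * fpsX \is a GRing.unit.
Proof.
by rewrite fps_unitE fcoefB fcoefCM fcoef1 /= mulr0 subr0 unitr1.
Qed.

Lemma fpsV_geom (a : R) : (1 - fpsC a * fpsX)^-1 = Fps (fun n => a ^+ n).
Proof.
apply: (mulrI (fps_unit_geom a)); rewrite divrr ?fps_unit_geom //.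
apply: fpsP => n; rewrite mulrBl mul1r -mulrA fcoefB fcoefCM fcoefXM fcoef1.
by case: n => [|n] /=; rewrite ?mulr0 ?subr0 ?expr0 // exprS subrr.
Qed.

End UnitRing.

(* The parts of a composition of s are at most s, hence the codomain 'I_s.+1,
   which makes the set of compositions a finite type. *)
Record composition (s n : nat) := Composition {
  parts : {ffun 'I_n -> 'I_s.+1};
  parts_sum : (\sum_(i < n) parts i == s)%N }.

HB.instance Definition _ s n := [isSub for @parts s n].
HB.instance Definition _ s n := [Finite of composition s n by <:].

Definition part s n (a : composition s n) (i : 'I_n) : nat := parts a i.
Coercion part : composition >-> Funclass.

Section EMD.
Variables (s p q : nat) (mu : composition s p) (nu : composition s q).

Definition transport : {pred 'M[nat]_(p, q)} := fun J =>
  [forall i, \sum_(j < q) J i j == mu i]%N &&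
  [forall j, \sum_(i < p) J i j == nu j]%N.

(* Rows and columns are numbered from 0, which does not affect |i - j|. *)
Definition cost (J : 'M[nat]_(p, q)) : nat :=
  (\sum_(i < p) \sum_(j < q) `|i - j| * J i j)%N.

Definition is_cost : pred nat :=
  fun c => `[< exists2 J, J \in transport & cost J = c >].

Lemma transport_ex : exists J, J \in transport.
Proof.
suff ex t (a : 'I_p -> nat) (b : 'I_q -> nat) :
    (\sum_i a i = t -> \sum_j b j = t -> exists J : 'M[nat]_(p, q),
      (forall i, \sum_j J i j = a i) /\ (forall j, \sum_i J i j = b j))%N.
  have [J [rJ cJ]] := ex s mu nu (eqP (parts_sum mu)) (eqP (parts_sum nu)).
  exists J; apply/andP.
  by split; apply/forallP => k; rewrite ?rJ ?cJ.
elim: t a b => [|t IHt] a b sa sb.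
  exists (const_mx 0%N); split=> k; rewrite big1 => [|l _]; rewrite ?mxE //.
    by apply/esym/eqP; move/eqP: sa; rewrite sum_nat_eq0 => /forallP/(_ k).
  by apply/esym/eqP; move/eqP: sb; rewrite sum_nat_eq0 => /forallP/(_ k).
have pos r (c : 'I_r -> nat) : (\sum_i c i = t.+1 -> exists i, 0 < c i)%N.
  move=> sc; apply/existsP; apply: contra_eqT sc => /existsPn c0.
  by rewrite big1 // => i _; apply/eqP; rewrite -leqn0 leqNgt.
have dec r (c : 'I_r -> nat) k : (0 < c k -> \sum_i c i = t.+1 ->
    \sum_i (c i - (i == k)) = t)%N.
  move=> ck sc; apply: succn_inj; rewrite -sc (bigD1 k) //= [RHS](bigD1 k) //=.
  rewrite eqxx -addSn subn1 prednK //; congr addn.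
  by apply: eq_bigr => i /negbTE->; rewrite subn0.
have [[i0 ai0] [j0 bj0]] := (pos _ a sa, pos _ b sb).
have [J [rJ cJ]] := IHt _ _ (dec _ _ _ ai0 sa) (dec _ _ _ bj0 sb).
exists (\matrix_(i, j) (J i j + (i == i0) * (j == j0))%N); split=> k.
  under eq_bigr do rewrite mxE.
  rewrite big_split /= rJ (bigD1 j0) //= eqxx muln1 big1 ?addn0.
    by rewrite subnK //; case: eqP => // ->.
  by move=> j /negbTE->; rewrite muln0.
under eq_bigr do rewrite mxE.
rewrite big_split /= cJ (bigD1 i0) //= eqxx mul1n big1 ?addn0.
  by rewrite subnK //; case: eqP => // ->.
by move=> i /negbTE->; rewrite mul0n.
Qed.

Lemma is_cost_ex : exists c, is_cost c.
Proof.
by have [J JP] := transport_ex; exists (cost J); apply/asboolP; exists J.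
Qed.

Definition EMD : nat := ex_minn is_cost_ex.

Lemma EMD_min :
  (exists2 J, J \in transport & cost J = EMD) /\
  (forall J, J \in transport -> EMD <= cost J)%N.
Proof.
rewrite /EMD; case: ex_minnP => c /asboolP cP c_min; split=> // J JP.
by apply/c_min/asboolP; exists J.
Qed.

End EMD.

(* H_{p,q}(z,t) in Z[z][[t]]: z is the polynomial variable 'X, t is fpsX. *)
Definition genH (p q : nat) : {fps {poly int}} :=
  if (0 < p)%N && (0 < q)%N then
    Fps (fun s =>
      \sum_(a : composition s p * composition s q) 'X ^+ EMD a.1 a.2)
  else 0.

(* Main.v *)
(* The coefficient of t^s is a sum over pairs (mu, nu). By inclusion-exclusion
   the pairs in which mu or nu ends with 0 contribute the numerator. When both
   last parts are positive, decreasing them by 1 lowers the EMD by |p - q|: by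
   the Monge inequality |i - j| + |p - q| <= |i - q| + |p - j| (i <= p, j <= q)
   some optimal transport moves a unit from p to q. *)
Require Import Defs.
From mathcomp Require Import all_boot all_order all_algebra.
From mathcomp Require Import zify.

Set Implicit Arguments.
Unset Strict Implicit.
Unset Printing Implicit Defensive.

Import GRing.Theory.
Local Open Scope ring_scope.

(** * Reindexing of finite sums *)

Lemma big_inj_image (R : Type) (idx : R) (op : Monoid.com_law idx)
    (I J : finType) (h : I -> J) (P : pred J) (F : J -> R) :
    injective h -> (forall i, P (h i)) -> (forall j, P j -> exists i, h i = j) ->
  \big[op/idx]_(j | P j) F j = \big[op/idx]_i F (h i).
Proof.
move=> h_inj Ph hP; rewrite -(big_imset _ (in2W h_inj)) /=.
apply: eq_bigl => j; apply/idP/imsetP => [/hP[i <-]|[i _ ->]]; first by exists i.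
exact: Ph.
Qed.

Lemma inj_pair (A B C D : Type) (f : A -> C) (g : B -> D) :
  injective f -> injective g -> injective (fun x => (f x.1, g x.2)).
Proof. by move=> f_inj g_inj [a b] [a' b'] [/f_inj-> /g_inj->]. Qed.

(** * Compositions: appending a zero part, increasing the last part *)

Lemma comp_inj s n (a b : composition s n) : a =1 b -> a = b.
Proof. by move=> ab; apply/val_inj/ffunP => i; apply/val_inj/ab. Qed.

Lemma comp_sum s n (a : composition s n) : (\sum_i a i = s)%N.
Proof. exact/eqP/(parts_sum a). Qed.

(** Each value is at most the total [s], so [inord] leaves it unchanged. *)
Fact of_fun_subproof s n (f : 'I_n -> nat) : (\sum_i f i = s)%N ->
  (\sum_i [ffun i => inord (f i) : 'I_s.+1] i == s)%N.
Proof.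
move=> fs; apply/eqP; rewrite -[RHS]fs; apply: eq_bigr => i _.
by rewrite ffunE inordK // ltnS -fs (bigD1 i) ?leq_addr.
Qed.

Definition of_fun s n (f : 'I_n -> nat) (fs : (\sum_i f i = s)%N) :
  composition s n := Composition (of_fun_subproof fs).

Lemma of_funE s n (f : 'I_n -> nat) (fs : (\sum_i f i = s)%N) i :
  of_fun fs i = f i.
Proof.
by rewrite /part ffunE inordK // ltnS -fs (bigD1 i) ?leq_addr.
Qed.

Definition snoc0 n (f : 'I_n -> nat) (i : 'I_n.+1) : nat :=
  if unlift ord_max i is Some j then f j else 0.

Fact ext0_subproof s n (a : composition s n) : (\sum_i snoc0 a i = s)%N.
Proof.
rewrite (bigD1_ord ord_max) //= {1}/snoc0 unlift_none add0n -[RHS](comp_sum a).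
by apply: eq_bigr => i _; rewrite /snoc0 liftK.
Qed.

Definition ext0 s n (a : composition s n) : composition s n.+1 :=
  of_fun (ext0_subproof a).

Lemma ext0_max s n (a : composition s n) : ext0 a ord_max = 0%N.
Proof. by rewrite of_funE /snoc0 unlift_none. Qed.

Lemma ext0_lift s n (a : composition s n) i : ext0 a (lift ord_max i) = a i.
Proof. by rewrite of_funE /snoc0 liftK. Qed.

Lemma ext0_inj s n : injective (@ext0 s n).
Proof. by move=> a b ab; apply: comp_inj => i; rewrite -ext0_lift ab ext0_lift. Qed.

Lemma ext0_surj s n (b : composition s n.+1) :
  b ord_max == 0%N -> exists a, ext0 a = b.
Proof.
move=> /eqP b0; have bs : (\sum_i b (lift ord_max i) = s)%N.
  by rewrite -[RHS](comp_sum b) (bigD1_ord ord_max) //= b0.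
exists (of_fun bs); apply: comp_inj => i.
by case: (unliftP ord_max i) => [j|] ->; rewrite ?ext0_max ?ext0_lift ?of_funE.
Qed.

Lemma sum_eq_ord n (i : 'I_n) : (\sum_(j < n) (j == i) = 1)%N.
Proof. by rewrite (bigD1 i) //= eqxx big1 // => j /negbTE->. Qed.

Fact incr_subproof s n (a : composition s n.+1) :
  (\sum_i (a i + (i == ord_max)) = s.+1)%N.
Proof. by rewrite big_split /= comp_sum sum_eq_ord addn1. Qed.

Definition incr s n (a : composition s n.+1) : composition s.+1 n.+1 :=
  of_fun (incr_subproof a).

Lemma incrE s n (a : composition s n.+1) i :
  incr a i = (a i + (i == ord_max))%N.
Proof. exact: of_funE. Qed.

Lemma incr_inj s n : injective (@incr s n).
Proof.
move=> a b ab; apply: comp_inj => i.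
by apply: (@addIn (i == ord_max)); rewrite -!incrE ab.
Qed.

Lemma incr_surj s n (b : composition s.+1 n.+1) :
  b ord_max != 0%N -> exists a, incr a = b.
Proof.
(* The truncated subtraction is exact because the last part of [b] is positive. *)
move=> b0; have bK i : (b i - (i == ord_max) + (i == ord_max) = b i)%N.
  by rewrite subnK //; case: eqP => // ->; rewrite lt0n.
have bs : (\sum_i (b i - (i == ord_max)) = s)%N.
  have := comp_sum b; rewrite -(eq_bigr _ (fun i _ => bK i)) big_split /=.
  by rewrite sum_eq_ord addn1 => -[].
by exists (of_fun bs); apply: comp_inj => i; rewrite incrE of_funE bK.
Qed.

Lemma comp0_eq n (a b : composition 0 n) : a = b.
Proof. by apply: comp_inj => i; rewrite /part !ord1. Qed.

Lemma comp_no_parts s : composition s.+1 0 -> False.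
Proof. by move=> a; have := comp_sum a; rewrite big_ord0. Qed.

(** * Comparing minimal costs; symmetry and appended zeros *)

Lemma transportP s p q (mu : composition s p) (nu : composition s q)
    (J : 'M_(p, q)) :
  reflect ((forall i, \sum_j J i j = mu i) /\ (forall j, \sum_i J i j = nu j))%N
          (J \in transport mu nu).
Proof.
apply: (iffP andP) => [[/'forall_eqP ? /'forall_eqP ?]|[? ?]] //.
by split; apply/'forall_eqP.
Qed.

(** Apply the hypothesis to an optimal [J']. Offsets on both sides let one form serve for upper and
    lower bounds without subtraction in [nat]. *)
Lemma EMD_le s s' p p' q q' (mu : composition s p) (nu : composition s q)
    (mu' : composition s' p') (nu' : composition s' q') (k k' : nat) :
    (forall J', J' \in transport mu' nu' ->
       exists2 J, J \in transport mu nu & cost J + k <= cost J' + k')%N ->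
  (EMD mu nu + k <= EMD mu' nu' + k')%N.
Proof.
have [_ EMDle] := EMD_min mu nu; have [[J' J'P <-] _] := EMD_min mu' nu'.
by move=> /(_ J' J'P)[J /EMDle]; lia.
Qed.

Lemma cost_tr p q (J : 'M_(p, q)) : cost J^T = cost J.
Proof.
rewrite /cost exchange_big; apply: eq_bigr => i _; apply: eq_bigr => j _.
by rewrite mxE distnC.
Qed.

Lemma transport_tr s p q (mu : composition s p) (nu : composition s q) J :
  J \in transport mu nu -> J^T \in transport nu mu.
Proof.
move=> /transportP[rJ cJ]; apply/transportP.
by split=> i; [rewrite -cJ | rewrite -rJ]; apply: eq_bigr => j _; rewrite mxE.
Qed.

Lemma EMD_sym s p q (mu : composition s p) (nu : composition s q) :
  EMD mu nu = EMD nu mu.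
Proof.
apply/eqP; rewrite eqn_leq -[EMD nu mu]addn0 -[EMD mu nu]addn0.
by apply/andP; split; apply: EMD_le => J /transport_tr JP;
  exists J^T; rewrite ?cost_tr.
Qed.

Lemma EMD_0 p q (mu : composition 0 p) (nu : composition 0 q) : EMD mu nu = 0%N.
Proof.
have [_ EMDle] := EMD_min mu nu; apply/eqP; rewrite -leqn0.
have cost0 : cost (const_mx 0%N : 'M_(p, q)) = 0%N.
  by rewrite /cost big1 // => i _; rewrite big1 // => j _; rewrite mxE muln0.
rewrite -[leqRHS]cost0; apply/EMDle/transportP.
split=> k; rewrite big1 => [|l _]; rewrite ?mxE //.
  by rewrite /part ord1.
by rewrite /part ord1.
Qed.

Lemma cost_last_row p q (J : 'M_(p.+1, q)) :
  cost J = (\sum_(j < q) `|p - j| * J ord_max j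
            + cost (\matrix_(i, j) J (lift ord_max i) j))%N.
Proof.
rewrite /cost (bigD1_ord ord_max) //; congr (_ + _)%N.
by apply: eq_bigr => i _; apply: eq_bigr => j _; rewrite mxE lift_max.
Qed.

(** Transports on the two sides correspond by adding or deleting a last row of zeros: a row of
    naturals with sum 0 is zero. Such a row costs nothing, and the other rows keep their indices. *)
Lemma EMD_ext0l s p q (mu : composition s p) (nu : composition s q) :
  EMD (ext0 mu) nu = EMD mu nu.
Proof.
apply/eqP; rewrite eqn_leq -[EMD mu nu]addn0 -[EMD (ext0 mu) nu]addn0.
apply/andP; split; apply: EMD_le => J /transportP[rJ cJ].
  pose K := \matrix_(i, j) snoc0 (J ^~ j) i.
  have Kmax j : K ord_max j = 0%N by rewrite mxE /snoc0 unlift_none.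
  have Klift i j : K (lift ord_max i) j = J i j by rewrite mxE /snoc0 liftK.
  exists K.
    apply/transportP; split=> [i|j].
      case: (unliftP ord_max i) => [i'|] ->.
        by rewrite ext0_lift -rJ; apply: eq_bigr.
      by rewrite ext0_max big1.
    by rewrite (bigD1_ord ord_max) //= Kmax -cJ; apply: eq_bigr.
  rewrite cost_last_row big1 => [|j _]; last by rewrite Kmax muln0.
  rewrite !addn0 add0n (_ : \matrix_(i, j) _ = J) //.
  by apply/matrixP => i j; rewrite mxE Klift.
have J0 j : J ord_max j = 0%N.
  apply/eqP; have /eqP := rJ ord_max; rewrite ext0_max sum_nat_eq0.
  by move=> /forallP/(_ j).
exists (\matrix_(i, j) J (lift ord_max i) j).
  apply/transportP; split=> [i|j].
    by rewrite -ext0_lift -rJ; apply: eq_bigr => j _; rewrite mxE.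
  rewrite -cJ [RHS](bigD1_ord ord_max) //= J0.
  by apply: eq_bigr => i _; rewrite mxE.
by rewrite (cost_last_row J) !addn0 leq_addl.
Qed.

Lemma EMD_ext0r s p q (mu : composition s p) (nu : composition s q) :
  EMD mu (ext0 nu) = EMD mu nu.
Proof. by rewrite EMD_sym EMD_ext0l EMD_sym. Qed.

(** * Matrix units, and the effect on the EMD of increasing both last parts *)

Definition cell p q (i : 'I_p) (j : 'I_q) : 'M[nat]_(p, q) :=
  \matrix_(x, y) ((x == i) * (y == j))%N.

Lemma cell_row p q (i : 'I_p) (j : 'I_q) x :
  (\sum_y cell i j x y = (x == i))%N.
Proof.
under eq_bigr do rewrite mxE.
by rewrite -big_distrr /= sum_eq_ord muln1.
Qed.

Lemma cell_col p q (i : 'I_p) (j : 'I_q) y :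
  (\sum_x cell i j x y = (y == j))%N.
Proof.
under eq_bigr do rewrite mxE.
by rewrite -big_distrl /= sum_eq_ord mul1n.
Qed.

Lemma cost_cell p q (i : 'I_p) (j : 'I_q) : cost (cell i j) = `|i - j|%N.
Proof.
rewrite /cost (bigD1 i) //= (bigD1 j) //= mxE !eqxx muln1.
rewrite big1 => [|y /negbTE yj]; last by rewrite mxE yj !muln0.
rewrite big1 ?addn0 // => x /negbTE xi.
by rewrite big1 // => y _; rewrite mxE xi muln0.
Qed.

Lemma mxDnE p q (J K : 'M[nat]_(p, q)) i j : (J + K) i j = (J i j + K i j)%N.
Proof. exact: mxE. Qed.

Lemma costD p q (J K : 'M_(p, q)) : cost (J + K) = (cost J + cost K)%N.
Proof.
rewrite /cost -big_split; apply: eq_bigr => i _.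
by rewrite -big_split; apply: eq_bigr => j _; rewrite mxDnE mulnDr.
Qed.

Lemma rowD p q (J K : 'M[nat]_(p, q)) i :
  (\sum_j (J + K)%R i j = \sum_j J i j + \sum_j K i j)%N.
Proof. by rewrite -big_split; apply: eq_bigr => j _; rewrite mxE. Qed.

Lemma colD p q (J K : 'M[nat]_(p, q)) j :
  (\sum_i (J + K)%R i j = \sum_i J i j + \sum_i K i j)%N.
Proof. by rewrite -big_split; apply: eq_bigr => i _; rewrite mxE. Qed.

(* One unit going from i to the last column and one going from the last row to
   j are rerouted: one now goes from i to j, and the one from the last row to
   the last column is dropped. When J has a unit in the last corner, i and j
   are both ord_max. *)
Lemma transport_incr_exchange s p q (mu : composition s p.+1)
    (nu : composition s q.+1) J : J \in transport (incr mu) (incr nu) ->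
  exists i j (K : 'M[nat]_(p.+1, q.+1)), K \in transport mu nu /\
    K + (cell i ord_max + cell ord_max j) = J + cell i j.
Proof.
move=> /transportP[rJ cJ].
have [i [j [Ji Jj ij]]] : exists i j,
    [/\ (0 < J i ord_max)%N, (0 < J ord_max j)%N
      & (i == ord_max) = (j == ord_max)].
  (* If the corner is empty, the last row and the last column still have positive sums, so each has
     a positive entry, necessarily off the corner. *)
  have [J0|Jpos] := posnP (J ord_max ord_max); last first.
    by exists ord_max, ord_max; rewrite !eqxx.
  have /existsP[i Ji] : [exists i, 0 < J i ord_max]%N.
    apply: contra_eqT (cJ ord_max) => /existsPn J0'.
    rewrite big1 => [|i _]; first by rewrite incrE eqxx addn1.
    by apply/eqP; rewrite -leqn0 leqNgt.
  have /existsP[j Jj] : [exists j, 0 < J ord_max j]%N.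
    apply: contra_eqT (rJ ord_max) => /existsPn J0'.
    rewrite big1 => [|j _]; first by rewrite incrE eqxx addn1.
    by apply/eqP; rewrite -leqn0 leqNgt.
  exists i, j; split=> //.
  have /negbTE-> : i != ord_max by apply: contraTneq Ji => ->; rewrite J0.
  by apply/esym/negbTE; apply: contraTneq Jj => ->; rewrite J0.
pose K : 'M[nat]_(p.+1, q.+1) := \matrix_(x, y)
  ((J + cell i j)%R x y - (cell i ord_max + cell ord_max j)%R x y)%N.
have KE : K + (cell i ord_max + cell ord_max j) = J + cell i j.
  apply/matrixP => x y; rewrite mxE [K x y]mxE; apply: subnK.
  (* Off the corner, the two subtracted cells lie in different rows, so at most 1 is subtracted
     anywhere, and [Ji] or [Jj] covers it. Otherwise all three cells are the corner: one subtraction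
     cancels against the added cell, and positivity of the corner covers the other. *)
  have [im|im] := eqVneq i ord_max; last first.
    have jm : j != ord_max by rewrite -ij.
    rewrite !mxDnE ![cell _ _ _ _]mxE; apply: leq_trans (leq_addr _ _).
    have [->|_] := eqVneq x i.
      rewrite (negbTE im) mul0n addn0 mul1n.
      by have [->|_] := eqVneq y ord_max.
    rewrite mul0n add0n; have [->|_] := eqVneq x ord_max => //.
    by have [->|_] := eqVneq y j.
  have jm : j = ord_max by apply/eqP; rewrite -ij im.
  rewrite im jm in Ji *; rewrite !mxDnE !mxE leq_add2r.
  have [->|_] := eqVneq x ord_max => //.
  by have [->|_] := eqVneq y ord_max.
exists i, j, K; split=> //; apply/transportP; split=> [x|y].
  have := rowD K (cell i ord_max + cell ord_max j) x.
  by rewrite KE !rowD !cell_row rJ incrE; lia.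
have := colD K (cell i ord_max + cell ord_max j) y.
by rewrite KE !colD !cell_col cJ incrE; lia.
Qed.

Lemma EMD_incr s p q (mu : composition s p.+1) (nu : composition s q.+1) :
  EMD (incr mu) (incr nu) = (`|p - q| + EMD mu nu)%N.
Proof.
(* Upper bound: send the additional unit straight through the corner, at cost [|p - q|]. *)
have le1 : (EMD (incr mu) (incr nu) + 0 <= EMD mu nu + `|p - q|)%N.
  apply: EMD_le => J /transportP[rJ cJ].
  exists (J + cell ord_max ord_max); last by rewrite costD cost_cell addn0.
  apply/transportP; split=> [x|y]; first by rewrite rowD cell_row rJ incrE.
  by rewrite colD cell_col cJ incrE.
suff : (EMD mu nu + `|p - q| <= EMD (incr mu) (incr nu) + 0)%N by lia.
apply: EMD_le => J /transport_incr_exchange[i [j [K [KP KE]]]].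
(* Taking costs in [KE] gives cost K + |i - q| + |p - j| = cost J + |i - j|. The Monge inequality,
   settled by [lia] from i <= p and j <= q, then yields the bound. *)
exists K => //; have := congr1 (@cost _ _) KE; rewrite !costD !cost_cell /=.
have := ltn_ord i; have := ltn_ord j; lia.
Qed.

(** * Recurrence for the coefficients and for the generating functions *)

Definition emdsum (s p q : nat) : {poly int} :=
  \sum_(a : composition s p * composition s q) 'X ^+ EMD a.1 a.2.

(** The value is 1 even for p = 0 or q = 0, through the empty composition of 0, whereas [genH] is
    then 0. Hence constant coefficients are treated apart. *)
Lemma emdsum0 p q : emdsum 0 p q = 1.
Proof.
have [a _] : {a : composition 0 p | true}.
  suff H : (\sum_(i < p) 0 = 0)%N by exists (of_fun H).
  by rewrite big1.
have [b _] : {b : composition 0 q | true}.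
  suff H : (\sum_(i < q) 0 = 0)%N by exists (of_fun H).
  by rewrite big1.
rewrite /emdsum (big_pred1 (a, b)) => [|[a' b']]; first by rewrite EMD_0.
by rewrite (comp0_eq a' a) (comp0_eq b' b); apply/esym/eqP.
Qed.

Lemma emdsum_p0 s q : emdsum s.+1 0 q = 0.
Proof. by apply: big1 => a _; case: (comp_no_parts a.1). Qed.

Lemma emdsum_0q s p : emdsum s.+1 p 0 = 0.
Proof. by apply: big1 => a _; case: (comp_no_parts a.2). Qed.

(** Pairs are sorted by whether the first ([P]) or the second ([Q]) composition ends with 0. [ext0]
    parametrizes the compositions ending with 0 and [incr] the others, which turns each class into a
    full sum with smaller parameters. *)
Lemma emdsum_rec s p q :
  emdsum s.+1 p.+1 q.+1 = emdsum s.+1 p q.+1 + emdsum s.+1 p.+1 q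
    - emdsum s.+1 p q + 'X ^+ `|p - q|%N * emdsum s p.+1 q.+1.
Proof.
pose T := (composition s.+1 p.+1 * composition s.+1 q.+1)%type.
pose F (a : T) : {poly int} := 'X ^+ EMD a.1 a.2.
pose P (a : T) := a.1 ord_max == 0%N; pose Q (a : T) := a.2 ord_max == 0%N.
have sumP : \sum_(a | P a) F a = emdsum s.+1 p q.+1.
  rewrite (big_inj_image _ (h := fun a => (ext0 a.1, a.2))) /=.
  - by apply: eq_bigr => a _; rewrite /F /= EMD_ext0l.
  - exact: inj_pair (@ext0_inj _ _) (@inj_id _).
  - by move=> a; rewrite /P /= ext0_max.
  by move=> [a b] /ext0_surj[a' /= <-]; exists (a', b).
have sumQ : \sum_(a | Q a) F a = emdsum s.+1 p.+1 q.
  rewrite (big_inj_image _ (h := fun a => (a.1, ext0 a.2))) /=.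
  - by apply: eq_bigr => a _; rewrite /F /= EMD_ext0r.
  - exact: inj_pair (@inj_id _) (@ext0_inj _ _).
  - by move=> a; rewrite /Q /= ext0_max.
  by move=> [a b] /ext0_surj[b' /= <-]; exists (a, b').
have sumPQ : \sum_(a | Q a && P a) F a = emdsum s.+1 p q.
  rewrite (big_inj_image _ (h := fun a => (ext0 a.1, ext0 a.2))) /=.
  - by apply: eq_bigr => a _; rewrite /F /= EMD_ext0l EMD_ext0r.
  - exact: inj_pair (@ext0_inj _ _) (@ext0_inj _ _).
  - by move=> a; rewrite /P /Q /= !ext0_max.
  move=> [a b] /andP[/ext0_surj[b' /= <-] /ext0_surj[a' /= <-]].
  by exists (a', b').
have sumN : \sum_(a | ~~ P a && ~~ Q a) F a
    = 'X ^+ `|p - q|%N * emdsum s p.+1 q.+1.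
  rewrite (big_inj_image _ (h := fun a => (incr a.1, incr a.2))) /=.
  - rewrite /emdsum big_distrr; apply: eq_bigr => a _.
    by rewrite /F /= EMD_incr exprD.
  - exact: inj_pair (@incr_inj _ _) (@incr_inj _ _).
  - by move=> a; rewrite /P /Q /= !incrE !eqxx !addn1.
  move=> [a b] /andP[/incr_surj[a' /= <-] /incr_surj[b' /= <-]].
  by exists (a', b').
have sumNQ : \sum_(a | ~~ P a && Q a) F a
    = emdsum s.+1 p.+1 q - emdsum s.+1 p q.
  rewrite -sumQ -sumPQ [\sum_(a | Q a) _](bigID P) /= addrAC subrr add0r.
  by apply: eq_bigl => a; rewrite andbC.
rewrite {1}/emdsum (bigID P) /= sumP (bigID Q) /= sumNQ sumN.
by rewrite !addrA.
Qed.

Lemma fcoef_genH0 p q : fcoef (genH p q) 0 = ((0 < p) && (0 < q))%N%:R.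
Proof. by rewrite /genH; case: ifP => // _; apply: emdsum0. Qed.

(** For a zero length the sum on the right is empty, in agreement with the convention that [genH]
    vanishes. *)
Lemma fcoef_genHS p q s : fcoef (genH p q) s.+1 = emdsum s.+1 p q.
Proof.
by case: p q => [|p] [|q]; rewrite ?emdsum_p0 ?emdsum_0q.
Qed.

Theorem theorem3 :
  (forall p q : nat, (0 < p)%N -> (0 < q)%N -> (p, q) <> (1%N, 1%N) ->
     genH p q =
       (genH (p - 1) q + genH p (q - 1) - genH (p - 1) (q - 1))
         / (1 - fpsC ('X ^+ `|p - q|%N) * fpsX))
  /\ genH 1 1 = 1 / (1 - fpsX).
Proof.
(* Both claims are proved after clearing the denominator, coefficient by coefficient. *)
have coef_mul0 p q : fcoef (genH p.+1 q.+1 *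
    (1 - fpsC ('X ^+ `|p.+1 - q.+1|%N) * fpsX)) 0 = 1.
  rewrite fcoefM big_ord1 fcoef_genH0 fcoefB fcoefCM fcoef1.
  by rewrite /= mulr0 subr0 mul1r.
have coef_mulS p q s : fcoef (genH p.+1 q.+1 *
    (1 - fpsC ('X ^+ `|p.+1 - q.+1|%N) * fpsX)) s.+1 =
    emdsum s.+1 p q.+1 + emdsum s.+1 p.+1 q - emdsum s.+1 p q.
  rewrite mulrBr mulr1 mulrC -mulrA fcoefB fcoefCM fcoefXM fcoef_genHS.
  have -> : `|p.+1 - q.+1|%N = `|p - q|%N by lia.
  by rewrite emdsum_rec addrK.
split=> [[|p] [|q] // _ _ pq|].
  apply: canRL (mulrK (fps_unit_geom _)) _; apply: fpsP => -[|s].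
    (* The numerator has constant coefficient 1 + 1 - 1, 1 + 0 - 0 or 0 + 1 - 0. For lengths (1, 1),
       excluded by [pq], it would be 0. *)
    rewrite coef_mul0 fcoefB fcoefD !fcoef_genH0 !subn1 /=.
    by case: p q pq => [|p] [|q] // _; rewrite ?subr0 ?add0r ?addr0 ?addrK.
  by rewrite coef_mulS fcoefB fcoefD !fcoef_genHS !subn1.
(* Writing t as z^0 t brings 1 - t into the form of the general denominator. *)
have -> : fpsX = fpsC ('X ^+ `|1 - 1|%N) * fpsX :> {fps {poly int}}.
  by rewrite distnn expr0 mul1r.
apply: canRL (mulrK (fps_unit_geom _)) _; apply: fpsP => -[|s].
  by rewrite coef_mul0.
by rewrite coef_mulS !emdsum_p0 emdsum_0q addr0 subr0.
Qed.
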